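(* Let $G$ be a connected graph of order $n\ge 2$ and let $H$ be a non-trivial graph. The following are equivalent: (i) there exists an adjacency basis $S$ for $H$ which is also a dominating set of $H$ and such that $S\not\subseteq N_H(v)$ for every $v\in V(H)\setminus S$; (ii) $\operatorname{dim}_A(G\odot H)=n\cdot \operatorname{dim}_A(H)$; (iii) $\operatorname{dim}_A(G\odot H)=\operatorname{dim}(G\odot H)$.
   Context: All graphs are finite, simple, undirected; non-trivial means order at least 2. For a connected graph, $d$ is shortest-path distance; a metric generator is a vertex set $S$ such that every two distinct vertices $x,y$ satisfy $d(s,x)\ne d(s,y)$ for some $s\in S$; $\operatorname{dim}$ is the minimum size of a metric generator. A set $S\subseteq V(H)$ is an adjacency generator for $H$ if for every two distinct $x,y\in V(H)\setminus S$ there exists $s\in S$ with $|N_H(s)\cap\{x,y\}|=1$ ($N_H$ the open neighbourhood); an adjacency basis is an adjacency generator of minimum cardinality, and this cardinality is $\operatorname{dim}_A(H)$. A dominating set $D$ satisfies $\bigcup_{v\in D}N_H[v]=V(H)$. The corona product $G\odot H$ ($G$ of order $n$ with vertices $v_1,\dots,v_n$) consists of $G$ and $n$ disjoint copies $H_1,\dots,H_n$ of $H$, with $v_i$ joined to every vertex of $H_i$. *)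

(* Defs.v *)
From mathcomp Require Export all_boot.

Set Implicit Arguments.
Unset Strict Implicit.
Unset Printing Implicit Defensive.

Record sgraph := SGraph {
  vertex :> finType;
  adj : rel vertex;
  adj_sym : symmetric adj;
  adj_irr : irreflexive adj }.

Section GraphNotions.
Variable G : sgraph.
Implicit Types (x y v : G) (S D : {set G}).

Definition connected := forall x y, connect (@adj G) x y.

Definition open_nbh v : {set G} := [set x | adj v x].

Definition closed_nbh v : {set G} := v |: open_nbh v.

Definition has_path x y (k : nat) : bool :=
  [exists p : k.-tuple G,
    [&& path (@adj G) x p, uniq (x :: p) & last x p == y]].

(* The least k such that x and y are joined by a path with k edges.  Paths
   have fewer than #|G| edges, so the search is exhaustive; pairs in different
   connected components get the value #|G|. *)
Definition dist x y : nat := find (has_path x y) (iota 0 #|G|).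

Definition metric_generator S : bool :=
  [forall x, forall y, (x != y) ==> [exists s in S, dist s x != dist s y]].

Definition adjacency_generator S : bool :=
  [forall x in ~: S, forall y in ~: S, (x != y) ==>
    [exists s in S, #|open_nbh s :&: [set x; y]| == 1]].

Definition metric_dim : nat :=
  #|[arg min_(S < [set: G] | metric_generator S) #|S|]|.

Definition adjacency_dim : nat :=
  #|[arg min_(S < [set: G] | adjacency_generator S) #|S|]|.

Definition adjacency_basis S : bool :=
  adjacency_generator S && (#|S| == adjacency_dim).

Definition dominating D : bool := \bigcup_(v in D) closed_nbh v == [set: G].

(* The minima defining the two dimensions range over nonempty families, as
   witnessed by the full vertex set. *)

Lemma dist_eq0 x y : (dist x y == 0) = (x == y).
Proof.
rewrite /dist; have : 0 < #|G| by apply/card_gt0P; exists x.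
case: #|G| => // n _ /=; case: ifP => [/existsP [p]|].
  by rewrite (tuple0 p) /= => ->.
move=> /existsP np; rewrite eqn0Ngt /=; apply/esym/negP => exy.
by apply: np; exists [tuple]; rewrite /= exy.
Qed.

Lemma metric_generatorT : metric_generator [set: G].
Proof.
apply/forallP => x; apply/forallP => y; apply/implyP => nxy.
apply/existsP; exists x; rewrite inE /=; apply/eqP => e.
have := dist_eq0 x y; rewrite -e (negPf nxy) => /eqP.
by have /eqP -> : dist x x == 0 by rewrite dist_eq0.
Qed.

Lemma adjacency_generatorT : adjacency_generator [set: G].
Proof. by apply/forall_inP => x; rewrite setCT inE. Qed.

Lemma metric_dimP :
  (exists2 S, metric_generator S & #|S| = metric_dim) /\
  (forall S, metric_generator S -> metric_dim <= #|S|).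
Proof.
rewrite /metric_dim; case: arg_minnP => [|S gS minS].
  exact: metric_generatorT.
by split=> //; exists S.
Qed.

Lemma adjacency_dimP :
  (exists2 S, adjacency_generator S & #|S| = adjacency_dim) /\
  (forall S, adjacency_generator S -> adjacency_dim <= #|S|).
Proof.
rewrite /adjacency_dim; case: arg_minnP => [|S gS minS].
  exact: adjacency_generatorT.
by split=> //; exists S.
Qed.

End GraphNotions.

Section Corona.
Variables G H : sgraph.

(* inl v is the vertex v of G; inr (v, h) is the vertex h in the copy of H
   attached to v. *)
Definition corona_adj (a b : G + G * H) : bool :=
  match a, b with
  | inl v, inl w => adj v w
  | inl v, inr (w, _) => v == w
  | inr (v, _), inl w => v == w
  | inr (v, h), inr (w, k) => (v == w) && adj h k
  end.

Lemma corona_adj_sym : symmetric corona_adj.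
Proof.
by move=> [v|[v h]] [w|[w k]] /=; rewrite ?[v == w]eq_sym // adj_sym.
Qed.

Lemma corona_adj_irr : irreflexive corona_adj.
Proof. by move=> [v|[v h]] /=; rewrite adj_irr ?andbF. Qed.

Definition corona : sgraph := SGraph corona_adj_sym corona_adj_irr.

End Corona.

(* Main.v *)
Require Import Defs.
From mathcomp Require Import all_boot.

Set Implicit Arguments.
Unset Strict Implicit.
Unset Printing Implicit Defensive.

(* Write W_i for the trace of a set W of vertices of G ⊙ H on the i-th copy
   of H.  Vertices outside that copy are equidistant from, and adjacent to all
   or none of, its vertices, and two vertices of the copy are at distance at
   most 2.  Hence if W is a metric generator or an adjacency generator of
   G ⊙ H, every W_i is an adjacency generator of H, and both dimensions are at
   least n dim_A(H).  Putting the same adjacency basis in every copy yields a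
   metric generator, so dim(G ⊙ H) = n dim_A(H) always, and (ii) <-> (iii).
   The same construction applied to a set as in (i) yields an adjacency
   generator.  Conversely, an adjacency generator W with n dim_A(H) elements
   avoids G, so its traces are adjacency bases; at most one vertex of all the
   copies is undominated, so, as n >= 2, some W_i is dominating, and
   W_i is not contained in N(v) since W separates v_i from v. *)

(** * Pointwise forms of separation and domination *)

Section Graphs.
Variable G : sgraph.
Implicit Types (x y z : G) (S : {set G}).

Lemma card_nbh_pair s x y : x != y ->
  (#|open_nbh s :&: [set x; y]| == 1) = (adj s x != adj s y).
Proof.
(* Removing [x] and then [y] empties the intersection, so its size is the sum of the two adjacency
   bits. *)
move=> nxy; rewrite (cardsD1 x) (cardsD1 y) !inE !eqxx orbT (eq_sym y) nxy !andbT.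
rewrite (_ : _ :\ y = set0) ?cards0 ?addn0; first by do 2!case: adj.
by apply/setP => z; rewrite !inE; do 2!case: eqP => ? //=; rewrite andbF.
Qed.

Lemma adjacency_generatorP S :
  reflect (forall x y, x \notin S -> y \notin S -> x != y ->
             exists2 s, s \in S & adj s x != adj s y)
          (adjacency_generator S).
Proof.
apply: (iffP forall_inP) => [gS x y xS yS nxy | gS x].
  rewrite -in_setC in xS; rewrite -in_setC in yS.
  have /forall_inP/(_ y yS) := gS x xS.
  rewrite nxy => /exists_inP[s sS]; rewrite card_nbh_pair // => sep.
  by exists s.
rewrite inE => xS; apply/forall_inP => y; rewrite inE => yS.
apply/implyP => nxy; have [s sS sep] := gS x y xS yS nxy.
by apply/exists_inP; exists s; rewrite ?card_nbh_pair.
Qed.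

Lemma metric_generatorP S :
  reflect (forall x y, x != y -> exists2 s, s \in S & dist s x != dist s y)
          (metric_generator S).
Proof.
apply: (iffP forallP) => [gS x y nxy | gS x].
  by have /forallP/(_ y)/implyP/(_ nxy)/exists_inP := gS x.
by apply/forallP => y; apply/implyP => nxy; apply/exists_inP/gS.
Qed.

(** Supplies a vertex [s] of the generator that can be used in every copy of [H]. *)
Lemma adjacency_generator_neq0 S :
  1 < #|G| -> adjacency_generator S -> exists s, s \in S.
Proof.
move=> /card_gt1P[x [y [_ _ nxy]]] /adjacency_generatorP gS.
have [xS|xS] := boolP (x \in S); first by exists x.
have [yS|yS] := boolP (y \in S); first by exists y.
by have [s sS _] := gS x y xS yS nxy; exists s.
Qed.

Lemma dominatingP S :
  reflect (forall x, x \notin S -> exists2 s, s \in S & adj s x) (dominating S).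
Proof.
apply: (iffP eqP) => [dS x xS | dS].
  have : x \in \bigcup_(v in S) closed_nbh v by rewrite dS inE.
  case/bigcupP => s sS; rewrite !inE => /orP[/eqP xs|]; last by exists s.
  by rewrite xs sS in xS.
apply/setP => x; rewrite inE; apply/bigcupP.
have [xS|/dS[s sS sx]] := boolP (x \in S); first by exists x; rewrite ?inE ?eqxx.
by exists s; rewrite ?inE ?sx ?orbT.
Qed.

(** * Shortest-path distance *)

Lemma distxx x : dist x x = 0.
Proof. by apply/eqP; rewrite dist_eq0. Qed.

Lemma dist_least x y k : has_path x y k -> dist x y <= k.
Proof.
(* A repetition-free path with [k] edges has [k.+1] vertices, so [k] lies in the search range. *)
move=> xyk; rewrite /dist; have kG : k < #|G|.
  case/existsP: xyk => p /and3P[_ /card_uniqP up _].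
  by have := max_card (mem (x :: p)); rewrite up /= size_tuple.
have h : has (has_path x y) (iota 0 #|G|).
  by apply/hasP; exists k; rewrite ?mem_iota.
rewrite leqNgt; apply/negP => lt_k; have := before_find 0 lt_k.
by rewrite nth_iota ?add0n ?xyk.
Qed.

Lemma has_path_shorten x p : path (@adj G) x p ->
  exists2 k, has_path x (last x p) k & k <= size p.
Proof.
move=> xp; case: (shortenP xp) => q xq uq qp.
exists (size q); last by apply: uniq_leq_size => //; case/andP: uq.
by apply/existsP; exists (in_tuple q); rewrite xq uq eqxx.
Qed.

Lemma dist_le_path x p : path (@adj G) x p -> dist x (last x p) <= size p.
Proof. by case/has_path_shorten => k /dist_least; apply: leq_trans. Qed.

Lemma dist_path x y : connect (@adj G) x y ->
  exists p, [/\ path (@adj G) x p, last x p = y & size p = dist x y].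
Proof.
case/connectP => p xp ->; have [k xk _] := has_path_shorten xp.
set z := last x p in xk *.
have kG : k < #|G|.
  case/existsP: xk => q /and3P[_ /card_uniqP uq _].
  by have := max_card (mem (x :: q)); rewrite uq /= size_tuple.
have h : has (has_path x z) (iota 0 #|G|).
  by apply/hasP; exists k; rewrite ?mem_iota.
have := nth_find 0 h; rewrite nth_iota; last by move: h; rewrite has_find size_iota.
by rewrite add0n => /existsP[q /and3P[xq _ /eqP lq]]; exists q; rewrite size_tuple.
Qed.

Lemma dist_adj_le s x y : connect (@adj G) s x -> adj x y ->
  dist s y <= (dist s x).+1.
Proof.
case/dist_path => p [sp lp sz] xy.
have := @dist_le_path s (rcons p y); rewrite rcons_path sp lp xy last_rcons.
by rewrite size_rcons sz; apply.
Qed.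

(** The penultimate vertex of a shortest path serves as [x]. *)
Lemma dist_pred s y : connect (@adj G) s y -> y != s ->
  exists2 x, adj x y & dist s y = (dist s x).+1.
Proof.
case/dist_path; case/lastP => [|p z] [sp lp sz]; first by rewrite -lp eqxx.
move: sp lp sz; rewrite rcons_path last_rcons size_rcons.
move=> /andP[sp pz] <- sz _; exists (last s p) => //; apply/eqP.
rewrite eqn_leq dist_adj_le //; last by apply/connectP; exists p.
by rewrite -sz ltnS dist_le_path.
Qed.

(** Growth by at most one per edge bounds [f] by the length of any path from [s]; descending along
    predecessors gives a path of length exactly [f y]. Distance formulas can thus be checked edge by
    edge. *)
Lemma dist_unique s (f : G -> nat) :
    f s = 0 -> (forall x y, adj x y -> f y <= (f x).+1) ->
    (forall y, y != s -> exists2 x, adj x y & f y = (f x).+1) ->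
  forall y, dist s y = f y.
Proof.
move=> fs f_le f_pred y.
have f_path p : path (@adj G) s p -> f (last s p) <= size p.
  elim/last_ind: p => [|p z IHp]; first by rewrite fs.
  rewrite rcons_path last_rcons size_rcons => /andP[/IHp le_p /f_le le_z].
  exact: leq_trans le_z _.
have [p [sp <- sz]] : exists p,
    [/\ path (@adj G) s p, last s p = y & size p = f y].
  move: {2}(f y) (erefl (f y)) => k; elim: k y => [|k IHk] y fy.
    exists [::]; split=> //.
    by apply/eqP; rewrite eq_sym; apply/negPn/negP=> /f_pred[x _]; rewrite fy.
  have nys : y != s by apply/eqP => ys; rewrite ys fs in fy.
  have [x xy e] := f_pred y nys.
  have /IHk[p [sp lp sz]] : f x = k by apply: succn_inj; rewrite -e.
  exists (rcons p y); rewrite rcons_path sp lp xy last_rcons size_rcons sz.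
  by rewrite e.
apply/eqP; rewrite eqn_leq; apply/andP; split.
  by apply: leq_trans (dist_le_path sp) _; rewrite sz.
have : connect (@adj G) s (last s p) by apply/connectP; exists p.
by case/dist_path => q [sq <- <-]; apply: f_path.
Qed.

End Graphs.

(** * Distances in the corona product *)

Section Corona.
Variables G H : sgraph.
Hypothesis G_conn : connected G.
Local Notation C := (corona G H).

(** Call [inl u] the hub of copy [u]. Non-adjacent vertices of one copy meet through their hub,
    whence 2; a path between two copies pays one edge to each hub. *)
Definition corona_dist (a b : C) : nat :=
  match a, b with
  | inl u, inl w => dist u w
  | inl u, inr (w, _) | inr (u, _), inl w => (dist u w).+1
  | inr (u, h), inr (w, k) =>
      if u == w then (if h == k then 0 else if adj h k then 1 else 2)
      else (dist u w).+2
  end.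

Lemma dist_corona (a b : C) : dist a b = corona_dist a b.
Proof.
move: b; apply: dist_unique.
- by case: a => [u|[u h]] /=; rewrite ?eqxx ?distxx.
- have leG (s x y : G) : adj x y -> dist s y <= (dist s x).+1.
    by move=> xy; apply: dist_adj_le.
  case: a => [u|[u h]] [x|[x k]] [y|[y l]] //=; rewrite ?ltnS.
  + exact: leG.
  + by move=> /eqP->.
  + by move=> /eqP->; apply: leqW.
  + by case/andP=> /eqP->.
  + exact: leG.
  + by move=> /eqP->; case: (u =P y) => [->|_]; rewrite ?distxx //; do 2?case: ifP.
  + move=> /eqP->; case: (u =P y) => [->|_]; rewrite ?distxx; last exact: leqW.
    by do 2?case: ifP.
  + case/andP=> /eqP-> kl; case: (u =P y) => // _.
    by case: (h =P k) => [->|_]; rewrite ?kl; do 4?case: ifP.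
(* The neighbour one step nearer to [a] is a predecessor in [G], the hub of the target's copy, or
   [a] itself. *)
- case: a => [u|[u h]] [y|[y l]] ne.
  + have nyu : y != u by apply: contraNneq ne => ->.
    by have [x xy e] := dist_pred (G_conn u y) nyu; exists (inl x).
  + by exists (inl y) => //=.
  + have [->|nyu] := eqVneq y u.
      by exists (inr (u, h)) => /=; rewrite ?eqxx ?distxx.
    by have [x xy e] := dist_pred (G_conn u y) nyu; exists (inl x) => //=; rewrite e.
  + rewrite /= eq_sym; have [yu|nyu] := eqVneq y u; last by exists (inl y) => /=.
    rewrite yu in ne *; have nlh : l != h by apply: contraNneq ne => ->.
    rewrite eq_sym (negPf nlh); case: ifP => hl.
      by exists (inr (u, h)) => /=; rewrite ?eqxx.
    by exists (inl u) => /=; rewrite ?eqxx ?distxx.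
Qed.

(** * Traces on the copies, and counting *)

Definition slice (W : {set C}) (i : G) : {set H} := [set h | inr (i, h) \in W].

Definition copies (S : {set H}) : {set C} :=
  [set a | if a is inr (_, h) then h \in S else false].

Lemma card_slices (W : {set C}) :
  #|W| = #|[set v | inl v \in W]| + \sum_i #|slice W i|.
Proof.
rewrite -sum1_card big_sumType /=; congr (_ + _).
  by rewrite -sum1_card; apply: eq_bigl => v; rewrite inE.
under [RHS]eq_bigr do rewrite -sum1_card.
by rewrite pair_big_dep /=; apply: eq_bigl => -[i h]; rewrite inE.
Qed.

Lemma card_copies (S : {set H}) : #|copies S| = #|G| * #|S|.
Proof.
rewrite card_slices (_ : [set v | _] = set0) ?cards0 ?add0n; last first.
  by apply/setP => v; rewrite !inE.
under eq_bigr => i _.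
  rewrite (_ : slice _ i = S); last by apply/setP => h; rewrite !inE.
  over.
by rewrite sum_nat_const.
Qed.

Lemma slice_adjacency_generator (W : {set C}) i :
  adjacency_generator W -> adjacency_generator (slice W i).
Proof.
move=> /adjacency_generatorP gW; apply/adjacency_generatorP => x y.
rewrite !inE => xW yW nxy.
have nxy' : inr (i, x) != inr (i, y) :> C by apply: contraNneq nxy => -[->].
have [[u|[u h]] sW /=] := gW _ _ xW yW nxy'; first by rewrite eqxx.
by have [eui|_] := eqVneq u i; rewrite //= => sep; exists h; rewrite ?inE -?eui.
Qed.

Lemma slice_metric_generator (W : {set C}) i :
  metric_generator W -> adjacency_generator (slice W i).
Proof.
move=> /metric_generatorP gW; apply/adjacency_generatorP => x y.
rewrite !inE => xW yW nxy.
have nxy' : inr (i, x) != inr (i, y) :> C by apply: contraNneq nxy => -[->].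
have [[u|[u h]] sW] := gW _ _ nxy'; rewrite !dist_corona /=; first by rewrite eqxx.
have [eui|_] := eqVneq u i; last by rewrite eqxx.
(* Since [h] differs from [x] and [y], both distances are 1 or 2, according to adjacency in [H]. *)
rewrite eui in sW; have nhx : h != x by apply: contraNneq xW => <-.
have nhy : h != y by apply: contraNneq yW => <-.
rewrite (negPf nhx) (negPf nhy) => sep; exists h; rewrite ?inE //.
by apply: contraNneq sep => ->.
Qed.

Lemma card_ge_slices (W : {set C}) :
  (forall i, adjacency_generator (slice W i)) ->
  #|G| * adjacency_dim H <= #|W|.
Proof.
move=> gW; rewrite card_slices; apply: leq_trans (leq_addl _ _).
rewrite -sum_nat_const; apply: leq_sum => i _.
by have [_] := adjacency_dimP H; apply.
Qed.

(** The traces alone already account for all of [#|W|], so nothing is left for [G] and each trace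
    attains its lower bound. *)
Lemma card_eq_slices (W : {set C}) :
    (forall i, adjacency_generator (slice W i)) ->
    #|W| = #|G| * adjacency_dim H ->
  (forall v, inl v \notin W) /\ (forall i, adjacency_basis (slice W i)).
Proof.
move=> gW; rewrite card_slices -sum_nat_const => cW.
have le_slice i : adjacency_dim H <= #|slice W i|.
  by have [_] := adjacency_dimP H; apply.
have [le_sum eq_sum] := leqif_sum (fun i (_ : i \in G) => leqif_eq (le_slice i)).
have W0 : #|[set v | inl v \in W]| = 0.
  by apply/eqP; rewrite -leqn0 -(leq_add2r (\sum_i #|slice W i|)) cW.
split=> [v|i].
  by have /setP/(_ v) := cards0_eq W0; rewrite !inE => ->.
move: cW; rewrite W0 add0n => /esym/eqP; rewrite eq_sum => /forall_inP/(_ i isT).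
by rewrite /adjacency_basis gW eq_sym.
Qed.

(** * Metric dimension of the corona *)

Lemma copies_metric_generator (S : {set H}) :
    1 < #|G| -> 1 < #|H| -> adjacency_generator S ->
  metric_generator (copies S).
Proof.
move=> G2 H2 gS; have [s sS] := adjacency_generator_neq0 H2 gS.
have sC i : inr (i, s) \in copies S by rewrite inE.
have far (i : G) : exists j, j != i.
  case/card_gt1P: G2 => [x [y [_ _ nxy]]].
  by have [xi|] := eqVneq x i; [exists y; rewrite -xi eq_sym | exists x].
(* A hub and a vertex of its own copy are told apart from another copy, which is one step farther
   from the latter; this uses a second vertex of [G]. *)
have sep_vh (v i : G) h : exists2 a,
    a \in copies S & corona_dist a (inl v) != corona_dist a (inr (i, h)).
  have [->|nvi] := eqVneq v i.
    have [j nji] := far i; exists (inr (j, s)) => //=.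
    by rewrite (negPf nji) neq_ltn ltnSn.
  by exists (inr (v, s)) => //=; rewrite (negPf nvi) distxx.
apply/metric_generatorP => -[v|[i h]] [w|[j k]] nab.
- exists (inr (v, s)) => //; rewrite !dist_corona /= distxx eqSS eq_sym dist_eq0.
  by apply: contraNneq nab => ->.
- by have [a aS sep] := sep_vh v j k; exists a; rewrite ?dist_corona.
- have [a aS sep] := sep_vh w i h; exists a => //.
  by rewrite !dist_corona eq_sym.
have [eij|nij] := eqVneq i j; last first.
  (* Within copy [i] distances are at most 2, while copy [j] is at distance [dist i j + 2]. *)
  exists (inr (i, s)) => //; rewrite !dist_corona /= eqxx (negPf nij).
  by do 2?case: ifP => _ //; rewrite !eqSS eq_sym dist_eq0.
rewrite -{j}eij in nab *.
have nhk : h != k by apply: contraNneq nab => ->.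
have sep_mem (x y : H) : x != y -> x \in S ->
    exists2 a, a \in copies S &
      corona_dist a (inr (i, x)) != corona_dist a (inr (i, y)).
  move=> nxy xS; exists (inr (i, x)); rewrite ?inE //= !eqxx (negPf nxy).
  by case: ifP.
have [hS|hS] := boolP (h \in S).
  by have [a aS sep] := sep_mem h k nhk hS; exists a; rewrite ?dist_corona.
have [kS|kS] := boolP (k \in S).
  rewrite eq_sym in nhk; have [a aS sep] := sep_mem k h nhk kS.
  by exists a; rewrite // !dist_corona eq_sym.
have /adjacency_generatorP/(_ _ _ hS kS nhk)[t tS sep] := gS.
exists (inr (i, t)); rewrite ?inE // !dist_corona /= eqxx.
have nth : t != h by apply: contraNneq hS => <-.
have ntk : t != k by apply: contraNneq kS => <-.
by rewrite (negPf nth) (negPf ntk); move: sep; do 2!case: adj.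
Qed.

Lemma metric_dim_corona : 1 < #|G| -> 1 < #|H| ->
  metric_dim C = #|G| * adjacency_dim H.
Proof.
move=> G2 H2; have [[W gW cW] minW] := metric_dimP C.
apply/eqP; rewrite eqn_leq; apply/andP; split.
  have [[S gS <-] _] := adjacency_dimP H; rewrite -card_copies.
  exact/minW/copies_metric_generator.
by rewrite -cW; apply: card_ge_slices => i; apply: slice_metric_generator.
Qed.

(** * Adjacency dimension of the corona *)

Lemma copies_adjacency_generator (S : {set H}) :
    1 < #|H| -> adjacency_generator S -> dominating S ->
    (forall v, v \notin S -> ~~ (S \subset open_nbh v)) ->
  adjacency_generator (copies S).
Proof.
move=> H2 gS /dominatingP dS nS; have [s sS] := adjacency_generator_neq0 H2 gS.
have sep_vh (v i : G) h : h \notin S ->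
    exists2 a : C, a \in copies S & adj a (inl v) != adj a (inr (i, h)).
  move=> hS; have [->|nvi] := eqVneq v i; last first.
    by exists (inr (v, s)); rewrite ?inE //= eqxx (negPf nvi).
  (* Every vertex of copy [i] is adjacent to its hub, so a member of [S] not adjacent to [h]
     separates the two. *)
  have /subsetPn[t tS] := nS h hS; rewrite inE adj_sym => tNh.
  by exists (inr (i, t)); rewrite ?inE //= eqxx (negPf tNh).
apply/adjacency_generatorP => -[v|[i h]] [w|[j k]]; rewrite !inE => aS bS nab.
- exists (inr (v, s)); rewrite ?inE //= eqxx.
  by have [vw|//] := eqVneq v w; rewrite vw eqxx in nab.
- exact: sep_vh.
- by have [a aC sep] := sep_vh w i h aS; exists a; rewrite // eq_sym.
have [eij|nij] := eqVneq i j.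
  rewrite -{j}eij in nab *; have nhk : h != k by apply: contraNneq nab => ->.
  have /adjacency_generatorP/(_ _ _ aS bS nhk)[t tS sep] := gS.
  by exists (inr (i, t)); rewrite ?inE //= eqxx.
(* For vertices in different copies, a dominator of [h] inside copy [i] has no neighbour in copy
   [j]. *)
have [t tS th] := dS h aS.
by exists (inr (i, t)); rewrite ?inE //= eqxx (negPf nij) th.
Qed.

(** Whatever separates the hub of copy [i] from [h] lies in copy [i], hence sees the hub and misses
    [h]. *)
Lemma slice_not_sub_nbh (W : {set C}) i h :
    adjacency_generator W -> (forall v, inl v \notin W) ->
  h \notin slice W i -> ~~ (slice W i \subset open_nbh h).
Proof.
move=> /adjacency_generatorP gW W0; rewrite inE => hW.
have [//|[v|[j k]] aW /= sep] := gW _ _ (W0 i) hW.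
  by have := W0 v; rewrite aW.
have [eji|nji] := eqVneq j i; last by rewrite (negPf nji) in sep.
rewrite eji eqxx /= in aW sep; apply/subsetPn; exists k; rewrite inE //.
by rewrite adj_sym; case: adj sep.
Qed.

(** With no hub in [W], a vertex undominated within its copy has no neighbour in [W] at all. *)
Lemma undominated_slice (W : {set C}) i : (forall v, inl v \notin W) ->
    ~~ dominating (slice W i) ->
  exists2 h, inr (i, h) \notin W & forall a, a \in W -> ~~ adj a (inr (i, h) : C).
Proof.
move=> W0 /dominatingP nd.
have /exists_inP[h hW nh] : [exists h in ~: slice W i,
    [forall t in slice W i, ~~ adj t h]].
  apply: contra_notT nd => /exists_inPn nex h hW.
  have := nex h; rewrite inE => /(_ hW)/forall_inPn[t tW].
  by rewrite negbK; exists t.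
rewrite !inE in hW; exists h => // -[v|[j t]] aW; first by have := W0 v; rewrite aW.
apply/negP => /andP[/eqP eji th]; have /forall_inP/(_ t) := nh.
by rewrite th inE -eji aW => /(_ isT).
Qed.

(** If two traces failed to dominate, each would leave a vertex without neighbours in [W], and [W]
    could not separate these two. *)
Lemma exists_dominating_slice (W : {set C}) : 1 < #|G| ->
    adjacency_generator W -> (forall v, inl v \notin W) ->
  exists i, dominating (slice W i).
Proof.
move=> /card_gt1P[i [j [_ _ nij]]] /adjacency_generatorP gW W0.
have [di|/(undominated_slice W0)[h hW nh]] := boolP (dominating (slice W i)).
  by exists i.
have [dj|/(undominated_slice W0)[k kW nk]] := boolP (dominating (slice W j)).
  by exists j.
have nhk : inr (i, h) != inr (j, k) :> C by apply: contraNneq nij => -[->].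
have [a aW] := gW _ _ hW kW nhk.
by rewrite (negPf (nh a aW)) (negPf (nk a aW)).
Qed.

Lemma adjacency_dim_corona : 1 < #|G| -> 1 < #|H| ->
  (exists S : {set H}, [/\ adjacency_basis S, dominating S &
     forall v, v \notin S -> ~~ (S \subset open_nbh v)]) <->
  adjacency_dim C = #|G| * adjacency_dim H.
Proof.
move=> G2 H2; have [[W gW cW] minW] := adjacency_dimP C.
have gWi i := slice_adjacency_generator i gW.
split=> [[S [/andP[gS /eqP cS] dS nS]]|].
  apply/eqP; rewrite eqn_leq -{2}cW card_ge_slices // andbT -cS -card_copies.
  exact/minW/copies_adjacency_generator.
rewrite -cW => /(card_eq_slices gWi)[W0 bW].
have [i di] := exists_dominating_slice G2 gW W0.
by exists (slice W i); split=> // h; apply: slice_not_sub_nbh.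
Qed.

End Corona.

Theorem theorem15 (G H : sgraph) (n : nat)
    (G_conn : connected G) (G_order : #|G| = n) (n_ge2 : 2 <= n)
    (H_nontrivial : 2 <= #|H|) :
  let cond_i :=
    exists S : {set H},
      [/\ adjacency_basis S, dominating S &
          forall v : H, v \notin S -> ~~ (S \subset open_nbh v)] in
  let cond_ii := adjacency_dim (corona G H) = n * adjacency_dim H in
  let cond_iii := adjacency_dim (corona G H) = metric_dim (corona G H) in
  (cond_i <-> cond_ii) /\ (cond_ii <-> cond_iii).
Proof.
(* With the metric dimension replaced by its value, (iii) becomes (ii). *)
subst n => /=; rewrite metric_dim_corona //.
by split=> //; apply: adjacency_dim_corona.
Qed.
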